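(* Let $(M,g)$ be an oriented Riemannian three-manifold, $P\to M$ a principal $G$-bundle, and $\zeta\in\Omega^2(M)$ a closed two-form. Let $A$ be a connection on $P$ and $B\in\Omega^0(M,Ad\,P)$ satisfy, for one of the two choices of sign, $$F_A+\zeta B=\pm * d_AB .$$ Then $(A,B)$ satisfies the cone Yang-Mills equations $$d_A^*(F_A+\zeta B)+[B,d_AB]=0,\qquad \zeta^*(F_A+\zeta B)+d_A^*d_AB=0 .$$
   Context: $G$ is a compact Lie group, a subgroup of $SO(N)$; $Ad\,P$ is the adjoint bundle, with an $Ad$-invariant fiber inner product. For a connection $A$ on $P$, $F_A\in\Omega^2(M,Ad\,P)$ is the curvature and $d_A$ the covariant derivative on $\Omega^*(M,Ad\,P)$. $*$ is the Hodge star of $g$. $d_A^*$ is the formal adjoint of $d_A$; on $k$-forms in dimension $m$, $d_A^*=(-1)^{mk+m+1}*d_A*$ (so $(-1)^k*d_A*$ when $m=3$). $\zeta^*:\Omega^k(M,Ad\,P)\to\Omega^{k-2}(M,Ad\,P)$ is the adjoint of $\zeta\wedge$, given by $\zeta^*=(-1)^{(m-k)k}*\zeta*$. *)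

(* Defs.v *)
From mathcomp Require Import all_boot all_order all_algebra all_fingroup.
From mathcomp Require Import all_classical all_reals all_analysis.

Set Implicit Arguments.
Unset Strict Implicit.
Unset Printing Implicit Defensive.

Import Order.TTheory GRing.Theory Num.Theory.
Import numFieldNormedType.Exports.

Local Open Scope classical_set_scope.
Local Open Scope ring_scope.

(* A manifold is given by an atlas, and a principal bundle by a
   total space with a right action and an atlas of local trivializations, i.e.
   of local sections.  A tensor field on M is given by its components in each
   chart, as functions of the coordinates; an Ad P-valued form, or a connection,
   by the components of its pullback along each of the local sections.  Fields
   are total functions, and their values are meaningful only on the image of
   the chart (for bundle-valued ones, on the [patch] where chart and section
   are both defined); equations between fields are required there only. *)

Section Smooth.
Context {R : realType} {m : nat}.

Definition basis_vec (mu : 'I_m) : 'rV[R]_m := delta_mx 0 mu.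

Definition pderiv (V : normedModType R) (mu : 'I_m) (f : 'rV[R]_m -> V)
    (y : 'rV[R]_m) : V :=
  'D_(basis_vec mu) f y.

Fixpoint Ck_on (V : normedModType R) (k : nat) (U : set 'rV[R]_m)
    (f : 'rV[R]_m -> V) : Prop :=
  (forall y, U y -> {for y, continuous f}) /\
  if k is k'.+1 then
    forall mu, (forall y, U y -> derivable f y (basis_vec mu)) /\
               Ck_on k' U (pderiv mu f)
  else True.

Definition smooth_on (V : normedModType R) (U : set 'rV[R]_m)
    (f : 'rV[R]_m -> V) : Prop :=
  forall k, Ck_on k U f.

End Smooth.

Section Groups.
Context {R : realType} {N : nat}.

Definition special_orthogonal : set 'M[R]_N :=
  [set a | a *m a^T = 1%:M /\ \det a = 1].

(* A compact subgroup of SO(N) is a closed, hence embedded, Lie subgroup: a map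
   into G is smooth iff it is smooth as a matrix-valued map. *)
Record compact_subgroup_SO (G : set 'M[R]_N) : Prop := {
  group1_SO : G 1%:M;
  groupM_SO : forall a b, G a -> G b -> G (a *m b);
  groupV_SO : forall a, G a -> G (invmx a);
  group_sub_SO : G `<=` special_orthogonal;
  group_compact_SO : compact G }.

(* The tangent space of G at the identity. *)
Definition lie_algebra (G : set 'M[R]_N) : set 'M[R]_N :=
  [set X | exists c : R -> 'M[R]_N,
     [/\ forall k t, derivable (derive1n k c) t 1,
         forall t, G (c t),
         c 0 = 1%:M
       & derive1 c 0 = X]].

Definition lie_bracket (X Y : 'M[R]_N) : 'M[R]_N := X *m Y - Y *m X.

End Groups.

(* A Hausdorff second countable space with a smooth atlas, all of whose
   transition maps preserve orientation. *)
Record oriented_manifold (R : realType) (m : nat) := OrientedManifold {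
  points :> topologicalType;
  points_hausdorff : hausdorff_space points;
  points_second_countable : @second_countable points;
  chart : Type;
  cdom : chart -> set points;
  coord : chart -> points -> 'rV[R]_m;
  param : chart -> 'rV[R]_m -> points;
  cimg := fun i => coord i @` cdom i;
  transition := fun i j y => coord j (param i y);
  cdom_open : forall i, open (cdom i);
  cimg_open : forall i, open (cimg i);
  cdom_cover : forall x, exists i, cdom i x;
  coordK : forall i x, cdom i x -> param i (coord i x) = x;
  coord_continuous : forall i, {within cdom i, continuous (coord i)};
  param_continuous : forall i, {within cimg i, continuous (param i)};
  transition_smooth : forall i j,
    smooth_on (cimg i `&` param i @^-1` cdom j) (transition i j);
  transition_oriented : forall i j y,
    cimg i y -> cdom j (param i y) -> 0 < \det ('J (transition i j) y) }.

(* ['J f y] acts on row vectors: its (mu, nu) entry is d f_nu / d y_mu. *)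
Record riemannian_metric (R : realType) (m : nat)
    (M : oriented_manifold R m) := RiemannianMetric {
  metric :> chart M -> 'rV[R]_m -> 'M[R]_m;
  metric_smooth : forall i, smooth_on (cimg i) (metric i);
  metric_sym : forall i y, cimg i y -> (metric i y)^T = metric i y;
  metric_pos : forall i y (v : 'rV[R]_m),
    cimg i y -> v != 0 -> 0 < (v *m metric i y *m v^T) 0 0;
  metric_change : forall i j y, cimg i y -> cdom j (param i y) ->
    metric i y = 'J (transition i j) y *m metric j (transition i j y)
                 *m ('J (transition i j) y)^T }.

(* [fibre a p] is the element of G with p = s_a(pi p) . fibre a p, so that
   p |-> (pi p, fibre a p) is the local trivialization attached to the local
   section s_a = [sect a].  The smooth structure of the total space is the one
   making the local trivializations diffeomorphisms; its consistency is
   [gauge_smooth], where s_b = s_a . [gauge a b]. *)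
Record principal_bundle (R : realType) (m N : nat)
    (M : oriented_manifold R m) (G : set 'M[R]_N) := PrincipalBundle {
  total :> topologicalType;
  proj : total -> M;
  act : total -> 'M[R]_N -> total;
  act1 : forall p, act p 1%:M = p;
  actM : forall p a b, G a -> G b -> act p (a *m b) = act (act p a) b;
  proj_act : forall p a, G a -> proj (act p a) = proj p;
  triv : Type;
  tdom : triv -> set M;
  sect : triv -> M -> total;
  fibre : triv -> total -> 'M[R]_N;
  gauge := fun a b x => fibre a (sect b x);
  tdom_open : forall a, open (tdom a);
  tdom_cover : forall x, exists a, tdom a x;
  proj_sect : forall a x, tdom a x -> proj (sect a x) = x;
  fibre_in : forall a p, tdom a (proj p) -> G (fibre a p);
  sectK : forall a p, tdom a (proj p) ->
    act (sect a (proj p)) (fibre a p) = p;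
  fibreK : forall a x u, tdom a x -> G u -> fibre a (act (sect a x) u) = u;
  proj_continuous : continuous proj;
  fibre_continuous : forall a,
    {within proj @^-1` tdom a, continuous (fibre a)};
  triv_continuous : forall a,
    {within tdom a `*` G, continuous (fun z => act (sect a z.1) z.2)};
  gauge_smooth : forall i a b,
    smooth_on (cimg i `&` param i @^-1` (tdom a `&` tdom b))
              (fun y => gauge a b (param i y)) }.

Section Fields.
Context {R : realType} {m : nat} (M : oriented_manifold R m).

(* Components w_I of a V-valued k-form: w = 1/k! sum_I w_I dy^I, with I ranging
   over all k-tuples of indices. *)
Definition field (V : Type) (k : nat) :=
  chart M -> 'rV[R]_m -> k.-tuple 'I_m -> V.

Definition alternating (V : lmodType R) k (w : k.-tuple 'I_m -> V) : Prop :=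
  forall (s : 'S_k) I, w [tuple tnth I (s r) | r < k] = (-1) ^+ s *: w I.

(* The value at y, in the chart i, of the pullback of the component field w by
   the transition map from the chart i to the chart j. *)
Definition pullback (V : lmodType R) k (w : field V k) (i j : chart M)
    (y : 'rV[R]_m) (I : k.-tuple 'I_m) : V :=
  \sum_(J : k.-tuple 'I_m)
    (\prod_(r < k) 'J (transition i j) y (tnth I r) (tnth J r))
      *: w j (transition i j y) J.

Definition exterior (V : normedModType R) k (w : field V k) : field V k.+1 :=
  fun i y I => \sum_(r < k.+1) (-1) ^+ r *:
    pderiv (tnth I r) (fun z => w i z [tuple tnth I (lift r s) | s < k]) y.

(* The wedge product with respect to the bilinear map op. *)
Definition wedge (U V : Type) (W : lmodType R) (op : U -> V -> W) (p q : nat)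
    (v : field U p) (w : field V q) : field W (p + q) :=
  fun i y I => (p`! * q`!)%:R^-1 *: \sum_(s : 'S_(p + q)) (-1) ^+ s *:
    op (v i y [tuple tnth I (s (lshift q r)) | r < p])
       (w i y [tuple tnth I (s (rshift p r)) | r < q]).

(* The Levi-Civita symbol of a sequence of m indices. *)
Definition levi_civita (s : seq 'I_m) : R :=
  \det (\matrix_(r < m, c < m) (nth m (map val s) r == c)%:R : 'M[R]_m).

(* ( *w)_J = sqrt(det g) / k! sum_I w^I epsilon_{IJ}, indices being raised with
   the inverse metric; thus v /\ *w = <v, w> vol. *)
Definition hodge (g : riemannian_metric M) (V : lmodType R) k (w : field V k) :
    field V (m - k) :=
  fun i y J => (Num.sqrt (\det (g i y)) / k`!%:R) *:
    \sum_(I : k.-tuple 'I_m) levi_civita (I ++ J) *: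
      \sum_(L : k.-tuple 'I_m)
        (\prod_(r < k) invmx (g i y) (tnth I r) (tnth L r)) *: w i y L.

End Fields.

Record diff_form (R : realType) (m : nat) (M : oriented_manifold R m)
    (k : nat) := DiffForm {
  form_field :> field M R^o k;
  form_smooth : forall i I, smooth_on (cimg i) (fun y => form_field i y I);
  form_alt : forall i y, cimg i y -> alternating (form_field i y);
  form_change : forall i j y I, cimg i y -> cdom j (param i y) ->
    form_field i y I = pullback form_field i j y I }.

Definition closed_form (R : realType) (m : nat) (M : oriented_manifold R m)
    (k : nat) (w : diff_form M k) : Prop :=
  forall i y I, cimg i y -> exterior w i y I = 0.

Section Bundle.
Context {R : realType} {m N : nat} {M : oriented_manifold R m}
        {G : set 'M[R]_N} (P : principal_bundle M G).

Definition ad_field (k : nat) := triv P -> field M 'M[R]_N k.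

Definition patch (a : triv P) (i : chart M) : set 'rV[R]_m :=
  cimg i `&` param i @^-1` tdom a.

Definition ad_eq k (v w : ad_field k) : Prop :=
  forall a i y I, patch a i y -> v a i y I = w a i y I.

Definition ad_zero k : ad_field k := fun _ _ _ _ => 0.
Definition ad_opp k (w : ad_field k) : ad_field k :=
  fun a i y I => - w a i y I.
Definition ad_add k (v w : ad_field k) : ad_field k :=
  fun a i y I => v a i y I + w a i y I.
Definition ad_scale k (c : R) (w : ad_field k) : ad_field k :=
  fun a i y I => c *: w a i y I.

(* Since s_b = s_a . h with h = gauge a b, components along s_b are obtained
   from those along s_a by Ad(h^-1). *)
Record ad_form (k : nat) := AdForm {
  ad_form_field :> ad_field k;
  ad_form_smooth : forall a i I,
    smooth_on (patch a i) (fun y => ad_form_field a i y I);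
  ad_form_lie : forall a i y I,
    patch a i y -> lie_algebra G (ad_form_field a i y I);
  ad_form_alt : forall a i y, patch a i y -> alternating (ad_form_field a i y);
  ad_form_change : forall a i j y I, patch a i y -> cdom j (param i y) ->
    ad_form_field a i y I = pullback (ad_form_field a) i j y I;
  ad_form_gauge : forall a b i y I, patch a i y -> patch b i y ->
    let h := gauge a b (param i y) in
    ad_form_field b i y I = invmx h *m ad_form_field a i y I *m h }.

(* The local connection forms A_a = s_a^* A, with
   A_b = Ad(h^-1) A_a + h^-1 dh. *)
Record connection := Connection {
  conn_field :> ad_field 1;
  conn_smooth : forall a i I,
    smooth_on (patch a i) (fun y => conn_field a i y I);
  conn_lie : forall a i y I,
    patch a i y -> lie_algebra G (conn_field a i y I);
  conn_change : forall a i j y I, patch a i y -> cdom j (param i y) ->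
    conn_field a i y I = pullback (conn_field a) i j y I;
  conn_gauge : forall a b i y I, patch a i y -> patch b i y ->
    let h := gauge a b (param i y) in
    conn_field b i y I = invmx h *m conn_field a i y I *m h
      + invmx h *m pderiv (tnth I ord0) (fun z => gauge a b (param i z)) y }.

Definition ad_bracket p q (v : ad_field p) (w : ad_field q) : ad_field (p + q) :=
  fun a => wedge lie_bracket (v a) (w a).

Definition form_wedge p q (z : diff_form M p) (w : ad_field q) :
    ad_field (p + q) :=
  fun a => wedge *:%R z (w a).

Definition ad_exterior k (w : ad_field k) : ad_field k.+1 :=
  fun a => exterior (w a).

(* F_A = dA + 1/2 [A /\ A] *)
Definition curvature (A : connection) : ad_field 2 :=
  ad_add (ad_exterior A) (ad_scale 2^-1 (ad_bracket A A)).

(* d_A w = dw + [A /\ w] *)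
Definition cov_ext (A : connection) k (w : ad_field k) : ad_field k.+1 :=
  ad_add (ad_exterior w) (ad_bracket A w).

Definition ad_hodge (g : riemannian_metric M) k (w : ad_field k) :
    ad_field (m - k) :=
  fun a => hodge g (w a).

(* The formal adjoint of d_A on k-forms, (-1)^(mk+m+1) * d_A *.  The degree is
   k - 1 for 0 < k <= m, by computation when k and m are numerals. *)
Definition cov_codiff (g : riemannian_metric M) (A : connection) k
    (w : ad_field k) : ad_field (m - (m - k).+1) :=
  ad_scale ((-1) ^+ (m * k + m + 1)) (ad_hodge g (cov_ext A (ad_hodge g w))).

(* The adjoint of z /\ on k-forms, (-1)^((m-k)k) * z *, of degree k - 2 for a
   two-form z. *)
Definition form_wedge_adj (g : riemannian_metric M) p (z : diff_form M p) k
    (w : ad_field k) : ad_field (m - (p + (m - k))) :=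
  ad_scale ((-1) ^+ ((m - k) * k)) (ad_hodge g (form_wedge z (ad_hodge g w))).

End Bundle.

Arguments ad_zero {R m N M G} P k.

(* Main.v *)
From HB Require Import structures.
Require Import Defs.
From mathcomp Require Import all_boot all_order all_algebra all_fingroup.
From mathcomp Require Import all_classical all_reals all_analysis.
From mathcomp Require Import ring lra.

Set Implicit Arguments.
Unset Strict Implicit.
Unset Printing Implicit Defensive.

Import Order.TTheory GRing.Theory Num.Theory.
Import numFieldNormedType.Exports.

Local Open Scope classical_set_scope.
Local Open Scope ring_scope.

(** Put phi = d_A B and Omega = F_A + zeta B, so that Omega = e * phi with
    e = 1 or e = -1.  On a Riemannian three-manifold ** = 1 on one-forms, hence
    also * Omega = e phi and * phi = e Omega.  Since d_A phi = [F_A, B]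
    = [Omega, B],
      d_A^* Omega = * d_A * Omega = e * [Omega, B] = ** [phi, B] = - [B, phi].
    By the Bianchi identity and d zeta = 0, d_A Omega = zeta /\ phi, so
      zeta^* Omega = * (zeta /\ * Omega) = e * (zeta /\ phi),
      d_A^* phi = - * d_A * phi = - e * d_A Omega = - e * (zeta /\ phi).
    All of this is local: in a chart and a trivialization d_A is
    d + [A /\ _], and its two identities reduce to the Leibniz rule, the Jacobi
    identity and the symmetry of second partial derivatives. *)

(** * Symmetry of mixed directional derivatives of scalar functions *)

Section Schwarz.
Context {R : realType} {V : normedModType R}.
Implicit Types (f : V -> R^o) (y u v : V).

(** The two difference quotients are the same function of [h]. This turns a directional derivative
    into a derivative in one variable, where the mean value theorem applies. *)
Lemma is_derive_line f (p w : V) (s : R) :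
  derivable f (p + s *: w) w ->
  is_derive s (1 : R) (fun t : R => f (p + t *: w)) ('D_w f (p + s *: w)).
Proof.
move=> df.
have E : (fun h : R => h^-1 *: (f (p + (h *: 1 + s) *: w) - f (p + s *: w)))
  = (fun h : R => h^-1 *: (f (h *: w + (p + s *: w)) - f (p + s *: w))).
  apply/funext => h.
  by rewrite [_%:A]mulr1 scalerDl addrCA.
by split; rewrite /derivable /derive /= E.
Qed.

Lemma MVT_line f (p w : V) (h : R) : 0 < h ->
  (forall s, 0 <= s <= h -> derivable f (p + s *: w) w) ->
  exists2 s, 0 <= s <= h & f (p + h *: w) - f p = h * 'D_w f (p + s *: w).
Proof.
move=> h0 df.
have [|||s + E] := @MVT_segment R (fun t => f (p + t *: w))
    (fun t => 'D_w f (p + t *: w)) 0 h.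
- exact: ltW.
- move=> s; rewrite in_itv /= => /andP[s0 sh].
  by apply/is_derive_line/df; rewrite !ltW.
- apply: derivable_within_continuous => s; rewrite in_itv /= => sh.
  by have [] := is_derive_line (df s sh).
rewrite in_itv /= => sh; exists s => //.
by move: E; rewrite scale0r addr0 subr0 mulrC.
Qed.

(** Symmetric in [u] and [v]; divided by [h ^+ 2] it is close to either mixed derivative at [y]. *)
Let second_difference f y u v (h : R) :=
  f (y + h *: u + h *: v) - f (y + h *: u) - (f (y + h *: v) - f y).

Let second_differenceC f y u v h :
  second_difference f y u v h = second_difference f y v u h.
Proof. by rewrite /second_difference (addrAC y); ring. Qed.

(** With [F z = f (z + h *: v) - f z] the second difference is [F (y + h *: u) - F y]. The mean
    value theorem along [u] turns it into [h] times an increment of ['D_u f] in the direction [v],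
    and a second use along [v] gives the other factor [h]. *)
Let second_difference_MVT f y u v (h : R) : 0 < h ->
  (forall s t : R, 0 <= s <= h -> 0 <= t <= h ->
     derivable f (y + s *: u + t *: v) u) ->
  (forall s t : R, 0 <= s <= h -> 0 <= t <= h ->
     derivable ('D_u f) (y + s *: u + t *: v) v) ->
  exists s t : R, [/\ 0 <= s <= h, 0 <= t <= h &
    second_difference f y u v h
      = h ^+ 2 * 'D_v ('D_u f) (y + s *: u + t *: v)].
Proof.
move=> h0 d1 d2.
have h0h : 0 <= h <= h by rewrite ltW /=.
have z0h : 0 <= (0 : R) <= h by rewrite lexx ltW.
pose F z := f (z + h *: v) - f z : R^o.
have dsh z : derivable f (z + h *: v) u ->
    is_derive z u (fun x => f (x + h *: v)) ('D_u f (z + h *: v)).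
  move=> D; have E : (fun k : R => k^-1 *: (f (k *: u + z + h *: v) - f (z + h *: v)))
    = (fun k : R => k^-1 *: (f (k *: u + (z + h *: v)) - f (z + h *: v))).
    by apply/funext => k; rewrite addrA.
  by split; rewrite /derivable /derive /= E.
have dF s : 0 <= s <= h -> is_derive (y + s *: u) u F
    ('D_u f (y + s *: u + h *: v) - 'D_u f (y + s *: u)).
  move=> sh; apply: is_deriveB; first exact/dsh/d1.
  by apply: derivableP; have := d1 s 0 sh z0h; rewrite scale0r addr0.
have [|s sh E] := @MVT_line F y u h h0.
  by move=> s sh; have [] := dF s sh.
have [_ E'] := dF s sh.
have [|t th E2] := @MVT_line ('D_u f) (y + s *: u) v h h0.
  by move=> t th; apply: d2.
exists s, t; split => //.
move: E; rewrite E' E2 /F => E.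
by rewrite /second_difference E expr2 mulrA.
Qed.

(** The mean value theorem produces different intermediate points for the two orders of
    differentiation, so the functions are compared at points [x1] and [x2] that are merely both
    close to [y]; the triangle inequality through the common value concludes. *)
Lemma eq_at_limit (F1 F2 : V -> R) y :
  {for y, continuous F1} -> {for y, continuous F2} ->
  (forall r : R, 0 < r -> exists x1 x2, [/\ ball y r x1, ball y r x2 & F1 x1 = F2 x2]) ->
  F1 y = F2 y.
Proof.
move=> c1 c2 H; apply/eqP; rewrite -subr_eq0 -normr_le0.
apply/ler_addgt0Pr => e e0; rewrite add0r.
have e20 : 0 < e / 2 by rewrite divr_gt0.
have /nbhs_ballP[r1 /= r10 b1] : nbhs y (fun z => `|F1 y - F1 z| < e / 2).
  by move/cvgrPdist_lt: c1; apply.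
have /nbhs_ballP[r2 /= r20 b2] : nbhs y (fun z => `|F2 y - F2 z| < e / 2).
  by move/cvgrPdist_lt: c2; apply.
have [|x1 [x2 [B1 B2 E]]] := H (Num.min r1 r2); first by rewrite lt_min r10.
have le1 : Num.min r1 r2 <= r1 by rewrite ge_min lexx.
have le2 : Num.min r1 r2 <= r2 by rewrite ge_min lexx orbT.
have /= a1 := b1 _ (le_ball le1 B1).
have /= a2 := b2 _ (le_ball le2 B2).
rewrite -(subrKA (F1 x1)); apply: (le_trans (ler_normD _ _)).
by rewrite [leRHS]splitr ltW // ltrD // E distrC.
Qed.

(** In every ball around [y] the symmetric second difference equals [h ^+ 2] times each of the mixed
    derivatives at some point. Dividing by [h ^+ 2] and shrinking the ball gives equality at [y] by
    continuity. *)
Lemma derive_comm f y u v (U : set V) : open U -> U y ->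
  (forall z, U z -> derivable f z u) -> (forall z, U z -> derivable f z v) ->
  (forall z, U z -> derivable ('D_u f) z v) ->
  (forall z, U z -> derivable ('D_v f) z u) ->
  {for y, continuous ('D_v ('D_u f))} -> {for y, continuous ('D_u ('D_v f))} ->
  'D_v ('D_u f) y = 'D_u ('D_v f) y.
Proof.
move=> oU Uy fu fv fuv fvu c1 c2; apply: (eq_at_limit c1 c2) => r' r'0.
have /nbhs_ballP[r0 /= r00 br0] : nbhs y U by apply: open_nbhs_nbhs.
pose r := Num.min r0 r'.
have r_gt0 : 0 < r by rewrite lt_min r00.
have br z : ball y r z -> U z.
  have rr0 : r <= r0 by rewrite ge_min lexx.
  by move=> /(le_ball rr0); exact: br0.
(* This makes [h * (|u| + |v| + 1)] equal to [r / 2], so the whole parallelogram with sides [h *: u]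
   and [h *: v] lies in the ball; the summand 1 keeps the denominator positive when both vectors
   vanish. *)
pose h := r / (2 * (`|u| + `|v| + 1)).
have d0 : 0 < `|u| + `|v| + 1 by rewrite ltr_wpDl // addr_ge0.
have h0 : 0 < h by rewrite divr_gt0 // mulr_gt0.
have inb (s t : R) : 0 <= s <= h -> 0 <= t <= h -> ball y r (y + s *: u + t *: v).
  move=> /andP[s0 sh] /andP[t0 th].
  rewrite -ball_normE /ball_ /= opprD addrA opprD addrA subrr sub0r -opprD normrN.
  apply: (le_lt_trans (ler_normD _ _)); rewrite !normrZ !ger0_norm //.
  apply: (@le_lt_trans _ _ (h * (`|u| + `|v|))).
    by rewrite mulrDr lerD // ler_wpM2r.
  apply: (@lt_trans _ _ (h * (`|u| + `|v| + 1))).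
    by rewrite ltr_pM2l // ltrDl.
  rewrite /h invfM mulrA divfK ?gt_eqF //; lra.
have inb' (s t : R) : 0 <= s <= h -> 0 <= t <= h -> ball y r (y + s *: v + t *: u).
  by move=> ? ?; rewrite addrAC; exact: inb.
have [s [t [sh th E1]]] := second_difference_MVT h0
  (fun s t sh th => fu _ (br _ (inb s t sh th)))
  (fun s t sh th => fuv _ (br _ (inb s t sh th))).
have [s' [t' [sh' th' E2]]] := second_difference_MVT h0
  (fun s t sh th => fv _ (br _ (inb' s t sh th)))
  (fun s t sh th => fvu _ (br _ (inb' s t sh th))).
have rr' : r <= r' by rewrite ge_min lexx orbT.
exists (y + s *: u + t *: v), (y + s' *: v + t' *: u); split.
- exact: (le_ball rr' (inb _ _ sh th)).
- exact: (le_ball rr' (inb' _ _ sh' th')).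
- apply: (@mulfI _ (h ^+ 2)); first by rewrite expf_neq0 // gt_eqF.
  exact: etrans (esym E1) (etrans (second_differenceC f y u v h) E2).
Qed.

End Schwarz.

(** * Product rules for matrix-valued functions, proved entry by entry *)

Section MatrixCalculus.
Context {R : realType} {V : normedModType R} {N : nat}.
Implicit Types (X Y : V -> 'M[R]_N) (f : V -> R^o) (y v : V).

Lemma derive_coord X y v p q :
  derivable X y v -> 'D_v X y p q = 'D_v (fun z => X z p q : R^o) y.
Proof. by move=> dX; rewrite derive_mx // mxE. Qed.

Lemma is_derive_mx X y v (dX : 'M[R]_N) :
  (forall p q, is_derive y v (fun z => X z p q : R^o) (dX p q)) ->
  is_derive y v X dX.
Proof.
move=> dXpq; have dX' : derivable X y v.
  by apply/derivable_mxP => p q; have [] := dXpq p q.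
split=> //; apply/matrixP => p q.
by rewrite derive_coord //; have [_ ->] := dXpq p q.
Qed.

Lemma is_derive_coord X y v (dX : 'M[R]_N) p q :
  is_derive y v X dX -> is_derive y v (fun z => X z p q : R^o) (dX p q).
Proof.
move=> [dX' <-]; split; last by rewrite derive_coord.
exact: (derivable_mxP _ _ _).1.
Qed.

Lemma is_derive_mulmx X Y y v (dX dY : 'M[R]_N) :
  is_derive y v X dX -> is_derive y v Y dY ->
  is_derive y v (fun z => X z *m Y z) (dX *m Y y + X y *m dY).
Proof.
move=> hX hY; apply: is_derive_mx => p q.
rewrite !mxE -big_split /=.
have -> : (fun z => (X z *m Y z) p q : R^o)
    = \sum_(k < N) ((fun z => X z p k : R^o) * (fun z => Y z k q : R^o)).
  by apply/funext => z; rewrite mxE fct_sumE.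
apply: is_derive_sum => k.
have := is_deriveM (is_derive_coord p k hX) (is_derive_coord k q hY).
by move/is_derive_eq; apply; rewrite addrC; congr (_ + _); rewrite [LHS]mulrC.
Qed.

Lemma is_derive_scalemx f X y v (df : R) (dX : 'M[R]_N) :
  is_derive y v f df -> is_derive y v X dX ->
  is_derive y v (fun z => (f z : R) *: X z) (df *: X y + f y *: dX).
Proof.
move=> hf hX; apply: is_derive_mx => p q; rewrite !mxE.
have -> : (fun z => (f z *: X z) p q : R^o) = f * (fun z => X z p q : R^o).
  by apply/funext => z; rewrite mxE.
have := is_deriveM hf (is_derive_coord p q hX).
by move/is_derive_eq; apply; rewrite addrC; congr (_ + _); rewrite [LHS]mulrC.
Qed.

Lemma is_derive_bracket X Y y v (dX dY : 'M[R]_N) :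
  is_derive y v X dX -> is_derive y v Y dY ->
  is_derive y v (fun z => lie_bracket (X z) (Y z))
    (lie_bracket dX (Y y) + lie_bracket (X y) dY).
Proof.
move=> hX hY.
have /is_derive_eq := is_deriveB (is_derive_mulmx hX hY) (is_derive_mulmx hY hX).
by apply; rewrite /lie_bracket opprD [- _ + - _]addrC addrACA.
Qed.

End MatrixCalculus.

(** * Partial derivatives of smooth functions on an open set *)

Lemma continuous_near_eq (T W : topologicalType) (f h : T -> W) x :
  (\near x, f x = h x) -> {for x, continuous f} -> {for x, continuous h}.
Proof.
move=> fh cf; rewrite /prop_for /continuous_at -(nbhs_singleton fh).
exact: cvg_trans (near_eq_cvg fh) cf.
Qed.

Section SmoothFunctions.
Context {R : realType} {m : nat}.
Implicit Types (U : set 'rV[R]_m) (mu nu : 'I_m).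

Lemma smooth_derivable (V : normedModType R) U (f : 'rV[R]_m -> V) y mu :
  smooth_on U f -> U y -> derivable f y (basis_vec mu).
Proof. by move=> /(_ 1%N)[_ /(_ mu)[df _]] /df. Qed.

Lemma smooth_pderiv (V : normedModType R) U (f : 'rV[R]_m -> V) mu :
  smooth_on U f -> smooth_on U (pderiv mu f).
Proof. by move=> sf k; have [_ /(_ mu)[]] := sf k.+1. Qed.

Lemma pderivP (V : normedModType R) U (f : 'rV[R]_m -> V) y mu :
  smooth_on U f -> U y -> is_derive y (basis_vec mu) f (pderiv mu f y).
Proof. by move=> sf Uy; apply/derivableP/(smooth_derivable sf). Qed.

Lemma eq_pderiv (V : normedModType R) U (f h : 'rV[R]_m -> V) y mu :
  open U -> U y -> (forall z, U z -> f z = h z) -> pderiv mu f y = pderiv mu h y.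
Proof.
move=> oU Uy fh; apply: near_eq_derive.
by apply: filterS (open_nbhs_nbhs (conj oU Uy)).
Qed.

(** Reduction to [derive_comm] for each entry. Taking an entry commutes with [pderiv] only where [f]
    is derivable, that is on [U]; openness of [U] lets these equalities pass through further
    derivatives and limits. *)
Lemma pderiv_comm N U (f : 'rV[R]_m -> 'M[R]_N) y mu nu :
  open U -> U y -> smooth_on U f ->
  pderiv mu (pderiv nu f) y = pderiv nu (pderiv mu f) y.
Proof.
move=> oU Uy sf.
have df rho z : U z -> derivable f z (basis_vec rho).
  by move=> Uz; exact: (smooth_derivable sf).
have ddf rho sig z : U z -> derivable (pderiv sig f) z (basis_vec rho).
  by move=> Uz; exact: (smooth_derivable (smooth_pderiv _ sf)).
apply/matrixP => p q.
have dE rho z : U z -> pderiv rho f z p q = pderiv rho (fun x => f x p q : R^o) z.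
  by move=> Uz; rewrite /pderiv derive_coord //; exact: df.
have ddE rho sig z : U z -> pderiv rho (pderiv sig f) z p q
    = pderiv rho (pderiv sig (fun x => f x p q : R^o)) z.
  move=> Uz; rewrite /pderiv derive_coord; last exact: ddf.
  by apply: (eq_pderiv _ oU) => // x /(dE sig).
have cont rho sig : {for y, continuous (pderiv rho (pderiv sig (fun x => f x p q : R^o)))}.
  have c : {for y, continuous (pderiv rho (pderiv sig f))}.
    by have [] := smooth_pderiv rho (smooth_pderiv sig sf) 0%N => /(_ y Uy).
  have c' : {for y, continuous (fun z => pderiv rho (pderiv sig f) z p q : R^o)}.
    exact: (continuous_comp c (@coord_continuous _ _ _ p q _)).
  apply: (continuous_near_eq _ c').
  by apply: filterS (open_nbhs_nbhs (conj oU Uy)) => z /(ddE rho sig).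
have d1 rho z : U z -> derivable (fun x => f x p q : R^o) z (basis_vec rho).
  by move=> /(df rho)/derivable_mxP.
have d2 rho sig z : U z ->
    derivable (pderiv sig (fun x => f x p q : R^o)) z (basis_vec rho).
  move=> Uz; have /derivable_mxP/(_ p q) := ddf rho sig z Uz.
  apply: near_eq_derivable; have := open_nbhs_nbhs (conj oU Uz).
  by apply: filterS => x /(dE sig).
apply: (etrans (ddE mu nu y Uy)); apply: (etrans _ (esym (ddE nu mu y Uy))).
by apply: (derive_comm oU Uy) => //; [exact: d1|exact: d1|exact: d2|exact: d2|
  exact: cont|exact: cont].
Qed.

End SmoothFunctions.

(** * Signed sums over permutations of at most three letters *)

Section PermutationSums.

(** A permutation is determined by the image [j] of 0 and the permutation [t] induced on the
    remaining letters. This parametrization is injective, hence bijective by counting: [n.+1 * n]! =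
    n.+1[!]. *)
Lemma sum_perm_lift (V : nmodType) n (F : 'S_n.+1 -> V) :
  \sum_s F s = \sum_(j < n.+1) \sum_(t : 'S_n) F (lift_perm ord0 j t).
Proof.
rewrite pair_big /= (reindex (fun p : 'I_n.+1 * 'S_n => lift_perm ord0 p.1 p.2)) //=.
apply: onW_bij; apply: inj_card_bij => [[j t] [j' t'] /= E|].
  have Ej : j = j' by rewrite -(lift_perm_id ord0 j t) E lift_perm_id.
  subst j'; congr (_, _); apply/permP => k; apply: (@lift_inj _ j).
  by rewrite -!(lift_perm_lift ord0) E.
by rewrite card_prod card_ord !card_Sn factS.
Qed.

Lemma sum_perm0 (V : nmodType) (F : 'S_0 -> V) : \sum_s F s = F 1%g.
Proof.
by rewrite (big_pred1 1%g) // => s; apply/esym/eqP/permP => -[].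
Qed.

Context {R : pzRingType} {V : lmodType R}.
Local Notation o0 := ord0.
Local Notation o1 := (lift ord0 ord0).
Local Notation o2 := (lift ord0 (lift ord0 ord0)).

(** Here and in the next two lemmas [H] takes natural numbers, so that the images of the letters
    reduce to numerals once [s] is a lifted permutation. *)
Lemma signed_sum_perm1 (H : nat -> V) :
  \sum_(s : 'S_1) (-1) ^+ s *: H (s o0) = H 0%N.
Proof.
rewrite sum_perm_lift big_ord_recl big_ord0 sum_perm0.
by rewrite odd_lift_perm odd_perm1 lift_perm_id /= addr0 expr0 scale1r.
Qed.

Lemma signed_sum_perm2 (H : nat -> nat -> V) :
  \sum_(s : 'S_2) (-1) ^+ s *: H (s o0) (s o1) = H 0%N 1%N - H 1%N 0%N.
Proof.
rewrite sum_perm_lift; under eq_bigr do rewrite sum_perm_lift.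
rewrite !big_ord_recl !big_ord0 !sum_perm0.
rewrite !(lift_perm_id, lift_perm_lift, odd_lift_perm, odd_perm1) /=.
by rewrite !addr0 expr0 expr1 scale1r scaleN1r.
Qed.

Lemma signed_sum_perm3 (H : nat -> nat -> nat -> V) :
  \sum_(s : 'S_3) (-1) ^+ s *: H (s o0) (s o1) (s o2) =
  H 0%N 1%N 2%N - H 0%N 2%N 1%N - H 1%N 0%N 2%N + H 1%N 2%N 0%N
  + H 2%N 0%N 1%N - H 2%N 1%N 0%N.
Proof.
rewrite sum_perm_lift; under eq_bigr do rewrite sum_perm_lift.
under eq_bigr do under eq_bigr do rewrite sum_perm_lift.
rewrite !big_ord_recl !big_ord0 !sum_perm0.
rewrite !(lift_perm_id, lift_perm_lift, odd_lift_perm, odd_perm1) /=.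
by rewrite !addr0 !expr0 !expr1 !scale1r !scaleN1r !addrA.
Qed.

End PermutationSums.

(** * Tuples of length at most three, and sums over them *)

Section SmallTuples.
Context {T : Type}.

Lemma mktuple0 (f : 'I_0 -> T) : [tuple f r | r < 0] = [tuple].
Proof. exact: tuple0. Qed.

Lemma mktuple1 (f : 'I_1 -> T) : [tuple f r | r < 1] = [tuple f ord0].
Proof. by apply: val_inj; rewrite /= enum_ordSl enum_ord0. Qed.

Lemma mktuple2 (f : 'I_2 -> T) :
  [tuple f r | r < 2] = [tuple f ord0; f (lift ord0 ord0)].
Proof. by apply: val_inj; rewrite /= !enum_ordSl enum_ord0. Qed.

Lemma mktuple3 (f : 'I_3 -> T) :
  [tuple f r | r < 3] =
  [tuple f ord0; f (lift ord0 ord0); f (lift ord0 (lift ord0 ord0))].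
Proof. by apply: val_inj; rewrite /= !enum_ordSl enum_ord0. Qed.

Lemma tuple_mktuple n (I : n.-tuple T) : I = [tuple tnth I r | r < n].
Proof. by apply: eq_from_tnth => r; rewrite tnth_mktuple. Qed.

Lemma tuple1P (I : 1.-tuple T) : exists a, I = [tuple a].
Proof. by exists (tnth I ord0); rewrite [LHS]tuple_mktuple mktuple1. Qed.

Lemma tuple2P (I : 2.-tuple T) : exists a b, I = [tuple a; b].
Proof.
exists (tnth I ord0), (tnth I (lift ord0 ord0)).
by rewrite [LHS]tuple_mktuple mktuple2.
Qed.

Lemma tuple3P (I : 3.-tuple T) : exists a b c, I = [tuple a; b; c].
Proof.
exists (tnth I ord0), (tnth I (lift ord0 ord0)), (tnth I (lift ord0 (lift ord0 ord0))).
by rewrite [LHS]tuple_mktuple mktuple3.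
Qed.

End SmallTuples.

Lemma sum_tuple1 (V : nmodType) (T : finType) (F : 1.-tuple T -> V) :
  \sum_I F I = \sum_a F [tuple a].
Proof.
rewrite (reindex (fun a : T => [tuple a])) //=; apply: onW_bij.
exists (fun I => tnth I ord0) => [a|I] //.
by have [a ->] := tuple1P I.
Qed.

Lemma sum_tuple2 (V : nmodType) (T : finType) (F : 2.-tuple T -> V) :
  \sum_I F I = \sum_a \sum_b F [tuple a; b].
Proof.
rewrite pair_big (reindex (fun p : T * T => [tuple p.1; p.2])) //=.
apply: onW_bij; exists (fun I => (tnth I ord0, tnth I (lift ord0 ord0))) => [[a b]|I] //.
by have [a [b ->]] := tuple2P I.
Qed.

(** * The Levi-Civita symbol in dimension three *)

Section LeviCivita.
Context {R : realType}.
Local Notation o1 := (lift ord0 ord0).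
Local Notation o2 := (lift ord0 (lift ord0 ord0)).

Lemma det3E (A : 'M[R]_3) :
  \det A = A ord0 ord0 * A o1 o1 * A o2 o2 - A ord0 ord0 * A o1 o2 * A o2 o1
    - A ord0 o1 * A o1 ord0 * A o2 o2 + A ord0 o1 * A o1 o2 * A o2 ord0
    + A ord0 o2 * A o1 ord0 * A o2 o1 - A ord0 o2 * A o1 o1 * A o2 ord0.
Proof.
(* [inord] turns the numerals of [signed_sum_perm3] back into column indices. *)
pose H (a b c : nat) : R^o := A ord0 (inord a) * A o1 (inord b) * A o2 (inord c).
have iE (a : 'I_3) k : nat_of_ord a = k -> inord k = a by move=> <-; rewrite inord_val.
have := @signed_sum_perm3 R R^o H.
rewrite /H (iE ord0 0%N) // (iE o1 1%N) // (iE o2 2%N) // => <-.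
apply: eq_bigr => s _; rewrite !big_ord_recl big_ord0 mulr1.
by rewrite !inord_val; congr (_ * _); rewrite mulrA.
Qed.

Lemma bump0n n : bump 0 n = n.+1.
Proof. by []. Qed.

(** A Vandermonde product: it vanishes when an index repeats, changes sign under transpositions, and
    the product for 0, 1, 2 is 2. As a polynomial expression it lets [field] evaluate the
    contractions below. *)
Lemma levi_civita3E (a b c : 'I_3) :
  levi_civita [:: a; b; c] =
  (b%:R - a%:R) * (c%:R - a%:R) * (c%:R - b%:R) / 2 :> R.
Proof.
rewrite /levi_civita det3E !mxE /=.
case: a => [[|[|[|//]]] ?]; case: b => [[|[|[|//]]] ?];
  case: c => [[|[|[|//]]] ?] /=; by field.
Qed.

(** The symbol of [l], [b], [c] is the determinant of the 0-1 matrix selecting these rows. Its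
    product with [h] consists of the rows [l], [b], [c] of [h], and the left side is the expansion
    of the determinant of that product. *)
Lemma det3_levi_civita (h : 'M[R]_3) (l b c : 'I_3) :
  \sum_a \sum_p \sum_q levi_civita [:: a; p; q] * (h l a * h b p * h c q)
  = \det h * levi_civita [:: l; b; c].
Proof.
have -> : levi_civita [:: l; b; c]
    = \det (\matrix_(r < 3, s < 3) (tnth [tuple l; b; c] r == s)%:R) :> R.
  rewrite /levi_civita; congr (\det _); apply/matrixP => r s; rewrite !mxE.
  by rewrite (tnth_nth l) (nth_map l) // ltn_ord.
rewrite mulrC -det_mulmx.
have E r s : ((\matrix_(r < 3, s < 3) (tnth [tuple l; b; c] r == s)%:R) *m h) r s
    = h (tnth [tuple l; b; c] r) s.
  rewrite mxE (bigD1 (tnth [tuple l; b; c] r)) //= mxE eqxx mul1r big1 ?addr0 // => k kr.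
  by rewrite mxE eq_sym (negPf kr) mul0r.
rewrite det3E !E !(tnth_nth l) /=.
rewrite !big_ord_recl !big_ord0 !levi_civita3E /= !bump0n.
by field.
Qed.

Lemma levi_civita3_contract (l n : 'I_3) :
  \sum_b \sum_c levi_civita [:: b; c; n] * levi_civita [:: l; b; c] = 2 * (l == n)%:R :> R.
Proof.
rewrite !big_ord_recl !big_ord0 !levi_civita3E /= !bump0n.
by case: l => [[|[|[|//]]] ?]; case: n => [[|[|[|//]]] ?] /=; field.
Qed.

End LeviCivita.

(** * Rearranging nested linear combinations *)

Lemma sum_scaler_sum (R : pzRingType) (V : lmodType R) (I J : finType)
    (a : I -> R) (b : I -> J -> R) (w : J -> V) :
  \sum_i a i *: (\sum_j b i j *: w j) = \sum_j (\sum_i a i * b i j) *: w j.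
Proof.
under eq_bigr do rewrite scaler_sumr.
rewrite exchange_big; apply: eq_bigr => j _; rewrite scaler_suml.
by apply: eq_bigr => i _; rewrite scalerA.
Qed.

Lemma scaler_sum_scale (R : pzRingType) (V : lmodType R) (J : finType)
    (c : R) (b : J -> R) (w : J -> V) :
  c *: (\sum_j b j *: w j) = \sum_j (c * b j) *: w j.
Proof. by rewrite scaler_sumr; apply: eq_bigr => j _; rewrite scalerA. Qed.

(** * Positivity of the determinant of a positive definite matrix *)

Section PositiveDefinite.
Context {R : rcfType} {n : nat}.
Implicit Type g : 'M[R]_n.

Lemma posdef_det_neq0 g :
  (forall v : 'rV_n, v != 0 -> 0 < (v *m g *m v^T) 0 0) -> \det g != 0.
Proof.
move=> pos; rewrite -unitfE -unitmxE -row_free_unit -kermx_eq0.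
apply/negPn/negP => /rowV0Pn[v]; rewrite sub_kermx => /eqP vg /pos.
by rewrite vg mul0mx mxE ltxx.
Qed.

(* The segment from 1 to g consists of positive definite matrices, so the
   determinant, which is 1 at the start, never vanishes along it. *)
Lemma posdef_det_gt0 g :
  (forall v : 'rV_n, v != 0 -> 0 < (v *m g *m v^T) 0 0) -> 0 < \det g.
Proof.
move=> pos.
(* The determinant along the segment is taken as a polynomial in the parameter, so that the
   intermediate value theorem for polynomials applies. *)
pose p := \det (map_mx polyC 1%:M + 'X *: map_mx polyC (g - 1%:M)).
have pE t : p.[t] = \det (1%:M + t *: (g - 1%:M)).
  rewrite -horner_evalE -det_map_mx; congr (\det _); apply/matrixP => r s.
  by rewrite !mxE /= horner_evalE !(hornerE, hornerC).
have pn0 t : 0 <= t <= 1 -> p.[t] != 0.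
  move=> /andP[t0 t1]; rewrite pE; apply: posdef_det_neq0 => v v0.
  have vv : 0 < (v *m v^T) 0 0.
    rewrite mxE; have [k vk] : exists k, v 0 k != 0.
      apply/existsP; apply: contraNT v0; rewrite negb_exists => /forallP v0.
      by apply/eqP/rowP => k; rewrite mxE; apply/eqP; have := v0 k; rewrite negbK.
    rewrite (bigD1 k) //= mxE ltr_pwDl //.
      by rewrite -expr2 exprn_even_gt0 //= vk.
    by apply: sumr_ge0 => l _; rewrite mxE -expr2 sqr_ge0.
  have -> : (v *m (1%:M + t *: (g - 1%:M)) *m v^T) 0 0
      = (1 - t) * (v *m v^T) 0 0 + t * (v *m g *m v^T) 0 0.
    rewrite mulmxDr mulmx1 -scalemxAr mulmxBr mulmx1 mulmxDl -scalemxAl mulmxBl.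
    move: (v *m v^T) (v *m g *m v^T) => X Y.
    by rewrite !mxE; ring.
  have vg := pos v v0.
  have [->|tn0] := eqVneq t 0; first by rewrite subr0 mul1r mul0r addr0.
  have t_gt0 : 0 < t by rewrite lt_def tn0.
  by apply: ltr_wpDl; [apply: mulr_ge0; rewrite ?subr_ge0 // ltW | exact: mulr_gt0].
have p1 : p.[1] = \det g by rewrite pE scale1r addrC subrK.
rewrite -p1 ltNge; apply/negP => p1le0.
(* The theorem asks for a passage from nonpositive to nonnegative values: [- p] is -1 at 0 and, by
   assumption, nonnegative at 1. *)
have [|t t01 /eqP] := @poly_ivt R (- p) 0 1 ler01.
  by rewrite !hornerN pE scale0r addr0 det1 oppr_ge0 p1le0 oppr_le0 ler01.
by rewrite hornerN => /eqP; rewrite oppr_eq0; apply/negP/pn0.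
Qed.

End PositiveDefinite.

(** * The Hodge star: linearity in the values, and its square on one-forms in dimension three *)

Section Hodge.
Context {R : realType} {m : nat} {M : oriented_manifold R m}.

(** The star only forms scalar combinations of the components at [y], hence commutes with every
    linear map of the value space. It serves below for scaling by a sign and for the bracket with
    [B]. *)
Lemma hodge_linear (g : riemannian_metric M) (V W : lmodType R) k
    (w : field M V k) (w' : field M W k) (f : {linear V -> W}) i y J :
  (forall I, w' i y I = f (w i y I)) -> hodge g w' i y J = f (hodge g w i y J).
Proof.
move=> E; rewrite /hodge [RHS]linearZ_LR [in RHS]linear_sum; congr (_ *: _).
apply: eq_bigr => I _; rewrite [RHS]linearZ_LR [in RHS]linear_sum; congr (_ *: _).
by apply: eq_bigr => L _; rewrite [RHS]linearZ_LR E.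
Qed.

Lemma det_metric_gt0 (g : riemannian_metric M) i y :
  cimg i y -> 0 < \det (g i y).
Proof. by move=> iy; apply: posdef_det_gt0 => v; exact: metric_pos. Qed.

End Hodge.

Section HodgeThree.
Context {R : realType} {M : oriented_manifold R 3}.

Lemma hodge_hodge1 (g : riemannian_metric M) (V : lmodType R)
    (w : field M V 1) i y J : cimg i y ->
  hodge g (hodge g w) i y J = w i y J.
Proof.
move=> iy; have dg := det_metric_gt0 g iy.
set G := g i y in dg; set s := Num.sqrt (\det G).
have s2 : s * s = \det G by rewrite -expr2 sqr_sqrtr // ltW.
set h := invmx G.
have hsym a b : h a b = h b a.
  have hT : h^T = h by rewrite trmx_inv (Defs.metric_sym g iy).
  by rewrite -[in LHS]hT mxE.
have dh : \det h = (\det G)^-1 by rewrite det_inv.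
have [n ->] := tuple1P J.
rewrite /hodge -/G -/s -/h.
(* The same expression by conversion, with the degrees [3 - 1] and [3 - (3 - 1)] written as
   numerals. *)
transitivity ((s / 2`!%:R) *: (\sum_(I : 2.-tuple 'I_3) levi_civita (I ++ [tuple n]) *:
  \sum_(L : 2.-tuple 'I_3) (\prod_(r < 2) h (tnth I r) (tnth L r)) *:
   ((s / 1`!%:R) *: (\sum_(K : 1.-tuple 'I_3) levi_civita (K ++ L) *:
     \sum_(Q : 1.-tuple 'I_3) (\prod_(r < 1) h (tnth K r) (tnth Q r)) *: w i y Q)))).
  by [].
(* The sums are exchanged until a single scalar coefficient stands before each component of [w];
   [coefE] shows this coefficient to be a Kronecker delta. *)
under eq_bigr => I _.
  under eq_bigr => L _ do rewrite sum_scaler_sum scaler_sum_scale.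
  rewrite sum_scaler_sum; over.
rewrite sum_scaler_sum scaler_sum_scale sum_tuple1.
have contract q b c : \sum_p \sum_r h b p * h c r *
    (s * \sum_a levi_civita [:: a; p; r] * h a q)
    = s * (\det h * levi_civita [:: q; b; c]).
  rewrite -det3_levi_civita.
  under eq_bigr => p _.
    under eq_bigr => r _ do rewrite !mulr_sumr.
    rewrite exchange_big; over.
  rewrite exchange_big mulr_sumr; apply: eq_bigr => a _.
  rewrite mulr_sumr; apply: eq_bigr => p _.
  rewrite mulr_sumr; apply: eq_bigr => r _.
  by rewrite (hsym a q); ring.
have coefE q : s / 2`!%:R * \sum_(I : 2.-tuple 'I_3) levi_civita (I ++ [tuple n]) *
    \sum_(L : 2.-tuple 'I_3) \prod_(r < 2) h (tnth I r) (tnth L r) *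
      (s / 1`!%:R * \sum_(K : 1.-tuple 'I_3) levi_civita (K ++ L) *
        \prod_(r < 1) h (tnth K r) (tnth [tuple q] r)) = (q == n)%:R.
  transitivity (s / 2 * \sum_b \sum_c levi_civita [:: b; c; n] *
      (s * (\det h * levi_civita [:: q; b; c]))).
    congr (_ * _); rewrite sum_tuple2; apply: eq_bigr => b _; apply: eq_bigr => c _.
    rewrite -contract sum_tuple2; congr (_ * _).
    apply: eq_bigr => p _; apply: eq_bigr => r _.
    by rewrite sum_tuple1 !big_ord_recl !big_ord0 !mulr1 divr1.
  transitivity (s * s * \det h / 2 *
      \sum_b \sum_c levi_civita [:: b; c; n] * levi_civita [:: q; b; c]).
    move: (\det h) => d.
    rewrite !mulr_sumr; apply: eq_bigr => b _; rewrite !mulr_sumr.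
    by apply: eq_bigr => c _; ring.
  rewrite levi_civita3_contract s2 dh mulfV; last by rewrite gt_eqF.
  by field.
transitivity (\sum_q (q == n)%:R *: w i y [tuple q]).
  by apply: eq_bigr => q _; congr (_ *: _); exact: coefE.
rewrite (bigD1 n) //= eqxx scale1r big1 ?addr0 // => q /negPf ->.
by rewrite scale0r.
Qed.

End HodgeThree.

(** * Components of wedge products in low degrees *)

Section WedgeComponents.
Context {R : realType} {m : nat} {M : oriented_manifold R m}.
Context {U V : Type} {W : lmodType R} (op : U -> V -> W).

Lemma wedge01 (v : field M U 0) (w : field M V 1) i y a :
  wedge op v w i y [tuple a] = op (v i y [tuple]) (w i y [tuple a]).
Proof.
(* Indices are read off by position, which gives the function of natural numbers that the signed
   sums expect; the other degrees follow the same scheme. *)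
pose H (r : nat) := op (v i y [tuple]) (w i y [tuple nth a [:: a] r]).
have := @signed_sum_perm1 R W H.
rewrite {2}/H /= => <-; rewrite /wedge mulr1n invr1 scale1r.
apply: eq_bigr => s _; rewrite /H mktuple0 mktuple1; congr (_ *: op _ (w i y _)).
by apply: val_inj; rewrite /= (tnth_nth a) /=; congr [:: nth _ _ (s _)]; apply: val_inj.
Qed.

Lemma wedge10 (v : field M U 1) (w : field M V 0) i y a :
  wedge op v w i y [tuple a] = op (v i y [tuple a]) (w i y [tuple]).
Proof.
pose H (r : nat) := op (v i y [tuple nth a [:: a] r]) (w i y [tuple]).
have := @signed_sum_perm1 R W H.
rewrite {2}/H /= => <-; rewrite /wedge mulr1n invr1 scale1r.
apply: eq_bigr => s _; rewrite /H mktuple0 mktuple1; congr (_ *: op (v i y _) _).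
by apply: val_inj; rewrite /= (tnth_nth a) /=; congr [:: nth _ _ (s _)]; apply: val_inj.
Qed.

Lemma wedge11 (v : field M U 1) (w : field M V 1) i y a b :
  wedge op v w i y [tuple a; b] =
  op (v i y [tuple a]) (w i y [tuple b]) - op (v i y [tuple b]) (w i y [tuple a]).
Proof.
pose H (r t : nat) :=
  op (v i y [tuple nth a [:: a; b] r]) (w i y [tuple nth a [:: a; b] t]).
have := @signed_sum_perm2 R W H.
rewrite {2 3}/H /= => <-; rewrite /wedge mulr1n invr1 scale1r.
apply: eq_bigr => s _; rewrite /H !mktuple1; congr (_ *: op (v i y _) (w i y _)).
all: apply: val_inj; rewrite /= !(tnth_nth a) /=.
all: by congr [:: nth _ _ (s _)]; apply: val_inj.
Qed.

Lemma wedge20 (v : field M U 2) (w : field M V 0) i y a b :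
  wedge op v w i y [tuple a; b] = 2^-1 *:
  (op (v i y [tuple a; b]) (w i y [tuple]) - op (v i y [tuple b; a]) (w i y [tuple])).
Proof.
pose H (r t : nat) :=
  op (v i y [tuple nth a [:: a; b] r; nth a [:: a; b] t]) (w i y [tuple]).
have := @signed_sum_perm2 R W H.
rewrite {2 3}/H /= => <-; rewrite /wedge; congr (_ *: _).
apply: eq_bigr => s _; rewrite /H mktuple0 mktuple2; congr (_ *: op (v i y _) _).
apply: val_inj; rewrite /= !(tnth_nth a) /=.
by congr [:: nth _ _ (s _); nth _ _ (s _)]; apply: val_inj.
Qed.

Lemma wedge12 (v : field M U 1) (w : field M V 2) i y a b c
    (H := fun a b c => op (v i y [tuple a]) (w i y [tuple b; c])) :
  wedge op v w i y [tuple a; b; c] = 2^-1 *: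
  (H a b c - H a c b - H b a c + H b c a + H c a b - H c b a).
Proof.
pose n r := nth a [:: a; b; c] r.
have := @signed_sum_perm3 R W (fun r s t => H (n r) (n s) (n t)).
rewrite /n /= => <-; rewrite /wedge; congr (_ *: _).
apply: eq_bigr => s _; rewrite /H mktuple1 mktuple2.
congr (_ *: op (v i y _) (w i y _)); apply: val_inj; rewrite /= !(tnth_nth a) /=.
  by congr [:: nth _ _ (s _)]; apply: val_inj.
by congr [:: nth _ _ (s _); nth _ _ (s _)]; apply: val_inj.
Qed.

Lemma wedge21 (v : field M U 2) (w : field M V 1) i y a b c
    (H := fun a b c => op (v i y [tuple a; b]) (w i y [tuple c])) :
  wedge op v w i y [tuple a; b; c] = 2^-1 *:
  (H a b c - H a c b - H b a c + H b c a + H c a b - H c b a).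
Proof.
pose n r := nth a [:: a; b; c] r.
have := @signed_sum_perm3 R W (fun r s t => H (n r) (n s) (n t)).
rewrite /n /= => <-; rewrite /wedge; congr (_ *: _).
apply: eq_bigr => s _; rewrite /H mktuple1 mktuple2.
congr (_ *: op (v i y _) (w i y _)); apply: val_inj; rewrite /= !(tnth_nth a) /=.
  by congr [:: nth _ _ (s _); nth _ _ (s _)]; apply: val_inj.
by congr [:: nth _ _ (s _)]; apply: val_inj.
Qed.

End WedgeComponents.

(** * Components of the exterior derivative in low degrees *)

Section ExteriorComponents.
Context {R : realType} {m : nat} {M : oriented_manifold R m}.
Context {V : normedModType R}.

Lemma exterior0 (w : field M V 0) i y a :
  exterior w i y [tuple a] = pderiv a (fun z => w i z [tuple]) y.
Proof.
rewrite /exterior big_ord_recl big_ord0 addr0 expr0 scale1r.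
by congr (pderiv _ _ _); apply/funext => z; congr (w i z _); exact: mktuple0.
Qed.

Lemma exterior1 (w : field M V 1) i y a b :
  exterior w i y [tuple a; b] =
  pderiv a (fun z => w i z [tuple b]) y - pderiv b (fun z => w i z [tuple a]) y.
Proof.
rewrite /exterior !big_ord_recl big_ord0 addr0 expr0 scale1r expr1 scaleN1r.
by congr (_ - _); congr (pderiv _ _ _); apply/funext => z; congr (w i z _);
  rewrite mktuple1; apply: val_inj.
Qed.

Lemma exterior2 (w : field M V 2) i y a b c :
  exterior w i y [tuple a; b; c] =
  pderiv a (fun z => w i z [tuple b; c]) y - pderiv b (fun z => w i z [tuple a; c]) y
  + pderiv c (fun z => w i z [tuple a; b]) y.
Proof.
rewrite /exterior !big_ord_recl big_ord0 addr0 expr0 scale1r expr1 scaleN1r.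
rewrite sqrrN expr1n scale1r addrA.
by congr (_ - _ + _); congr (pderiv _ _ _); apply/funext => z;
  congr (w i z _); rewrite mktuple2; apply: val_inj.
Qed.

End ExteriorComponents.

(** * Bilinearity of the matrix commutator *)

Section LieBracket.
Context {R : realType} {N : nat}.
Implicit Types X Y : 'M[R]_N.

Lemma lie_bracketC X Y : lie_bracket X Y = - lie_bracket Y X.
Proof. by rewrite /lie_bracket opprB. Qed.

Lemma lie_bracketxx X : lie_bracket X X = 0.
Proof. by rewrite /lie_bracket subrr. Qed.

Lemma lie_bracket_linear X : linear (lie_bracket X).
Proof.
move=> c Y Z; rewrite /lie_bracket mulmxDr mulmxDl -scalemxAr -scalemxAl.
by rewrite scalerBr opprD addrACA.
Qed.

HB.instance Definition _ X := GRing.isLinear.Build R 'M[R]_N 'M[R]_N _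
  (lie_bracket X) (lie_bracket_linear X).

(** The bracket as a function of its left argument, named so that it can carry a linear structure
    and be fed to [hodge_linear]. *)
Definition lie_bracketr Y X := lie_bracket X Y.

Lemma lie_bracketr_linear Y : linear (lie_bracketr Y).
Proof.
by move=> c X Z; rewrite /lie_bracketr !(lie_bracketC _ Y) linearP opprD scalerN.
Qed.

HB.instance Definition _ Y := GRing.isLinear.Build R 'M[R]_N 'M[R]_N _
  (lie_bracketr Y) (lie_bracketr_linear Y).

End LieBracket.

(** * Linearity of the wedge product in its second factor *)

Section WedgeLinear.
Context {R : realType} {m : nat} {M : oriented_manifold R m}.
Context {U : Type} {V W : lmodType R} (op : U -> {linear V -> W}) {p q : nat}.

Lemma wedgeDr (u : field M U p) (v w : field M V q) i y I :
  wedge op u (fun i y J => v i y J + w i y J) i y I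
  = wedge op u v i y I + wedge op u w i y I.
Proof.
rewrite /wedge -scalerDr -big_split; congr (_ *: _); apply: eq_bigr => s _.
by rewrite linearD scalerDr.
Qed.

Lemma wedgeZr c (u : field M U p) (v : field M V q) i y I :
  wedge op u (fun i y J => c *: v i y J) i y I = c *: wedge op u v i y I.
Proof.
rewrite /wedge scalerA mulrC -scalerA; congr (_ *: _).
rewrite scaler_sumr; apply: eq_bigr => s _.
by rewrite linearZ_LR scalerA mulrC -scalerA.
Qed.

End WedgeLinear.

Lemma eq_wedge (R : realType) m (M : oriented_manifold R m) (U V : Type)
    (W : lmodType R) (op : U -> V -> W) p q (u : field M U p)
    (v w : field M V q) i y I :
  (forall J, v i y J = w i y J) -> wedge op u v i y I = wedge op u w i y I.
Proof.
by move=> vw; rewrite /wedge; congr (_ *: _); apply: eq_bigr => s _; rewrite vw.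
Qed.

(** * The covariant exterior derivative and the curvature in local components *)

Section BundleCalculus.
Context {R : realType} {m N : nat} {M : oriented_manifold R m}
        {G : set 'M[R]_N} {P : principal_bundle M G}.
Implicit Types (A : connection P).

(** [param i] is continuous within the open set [cimg i], hence continuous at each of its points, so
    the preimage of [tdom a] is a neighbourhood there. *)
Lemma patch_open (a : triv P) i : open (Defs.patch a i).
Proof.
rewrite openE => y [iy ay].
have : {in cimg i, continuous (param i)}.
  by rewrite -continuous_open_subspace; [exact: param_continuous|exact: cimg_open].
move=> /(_ y); rewrite inE => /(_ iy) cy.
have n1 : nbhs y (cimg i) by apply: open_nbhs_nbhs; split; [exact: cimg_open|].
have n2 : nbhs y (param i @^-1` tdom a).
  by apply: cy; apply: open_nbhs_nbhs; split; [exact: tdom_open|].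
exact: filterI n1 n2.
Qed.

(** The regularity under which [cov_ext] is linear, for fields such as the curvature that are not
    packaged as an [ad_form]. *)
Definition ad_derivable k (w : ad_field P k) := forall a i y I mu,
  Defs.patch a i y -> derivable (fun z => w a i z I) y (basis_vec mu).

Lemma pderiv_val (V : normedModType R) (f : 'rV[R]_m -> V) y mu df :
  is_derive y (basis_vec mu) f df -> pderiv mu f y = df.
Proof. by case. Qed.

(** [ad_eq] gives equality on patches only; since these are open, derivatives agree there as
    well. *)
Lemma eq_cov_ext A k (v w : ad_field P k) :
  ad_eq v w -> ad_eq (cov_ext A v) (cov_ext A w).
Proof.
move=> vw a i y I Py.
have E1 : ad_exterior v a i y I = ad_exterior w a i y I.
  apply: eq_bigr => r _; congr (_ *: _).
  apply: (@eq_pderiv _ _ _ (Defs.patch a i)) => // [|z Pz]; first exact: patch_open.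
  exact: vw.
have E2 : ad_bracket A v a i y I = ad_bracket A w a i y I.
  by apply: eq_wedge => J; exact: vw.
by rewrite /cov_ext /ad_add E1 E2.
Qed.

Lemma cov_extZ A c k (w : ad_field P k) : ad_derivable w ->
  ad_eq (cov_ext A (ad_scale c w)) (ad_scale c (cov_ext A w)).
Proof.
move=> dw a i y I Py; rewrite [RHS]scalerDr; congr (_ + _).
  rewrite [RHS]scaler_sumr; apply: eq_bigr => r _.
  rewrite scalerA mulrC -scalerA; congr (_ *: _).
  by apply: pderiv_val; apply: is_deriveZ; apply/derivableP/dw.
exact: (wedgeZr (fun X => lie_bracket X)).
Qed.

Lemma cov_extD A k (v w : ad_field P k) : ad_derivable v -> ad_derivable w ->
  ad_eq (cov_ext A (ad_add v w)) (ad_add (cov_ext A v) (cov_ext A w)).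
Proof.
move=> dv dw a i y I Py; rewrite /ad_add addrACA; congr (_ + _).
  rewrite -[RHS]big_split; apply: eq_bigr => r _ /=.
  rewrite -[RHS]scalerDr; congr (_ *: _).
  by apply: pderiv_val; apply: is_deriveD; apply/derivableP; [apply: dv|apply: dw].
exact: (wedgeDr (fun X => lie_bracket X)).
Qed.

Lemma cov_ext0E A (w : ad_field P 0) a i y mu :
  cov_ext A w a i y [tuple mu] =
  pderiv mu (fun z => w a i z [tuple]) y
  + lie_bracket (conn_field A a i y [tuple mu]) (w a i y [tuple]).
Proof. by congr (_ + _); [exact: exterior0 | exact: wedge10]. Qed.

Lemma cov_ext1E A (w : ad_field P 1) a i y mu nu :
  cov_ext A w a i y [tuple mu; nu] =
  pderiv mu (fun z => w a i z [tuple nu]) y - pderiv nu (fun z => w a i z [tuple mu]) y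
  + (lie_bracket (conn_field A a i y [tuple mu]) (w a i y [tuple nu])
     - lie_bracket (conn_field A a i y [tuple nu]) (w a i y [tuple mu])).
Proof. by congr (_ + _); [exact: exterior1 | exact: wedge11]. Qed.

(** The wedge of [A] with itself yields two equal brackets, which the factor 1/2 in the curvature
    merges. *)
Lemma curvatureE A a i y mu nu :
  curvature A a i y [tuple mu; nu] =
  pderiv mu (fun z => conn_field A a i z [tuple nu]) y
  - pderiv nu (fun z => conn_field A a i z [tuple mu]) y
  + lie_bracket (conn_field A a i y [tuple mu]) (conn_field A a i y [tuple nu]).
Proof.
congr (_ + _); first exact: exterior1.
rewrite /ad_scale (_ : ad_bracket A A a i y [tuple mu; nu] =
  lie_bracket (conn_field A a i y [tuple mu]) (conn_field A a i y [tuple nu])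
     - lie_bracket (conn_field A a i y [tuple nu]) (conn_field A a i y [tuple mu]));
  last exact: wedge11.
rewrite (lie_bracketC (conn_field A a i y [tuple nu])) opprK.
by move: (lie_bracket _ _) => X; apply/matrixP => r s; rewrite !mxE; field.
Qed.

(** By antisymmetry of [w] the six terms of [wedge12] coincide in pairs, which absorbs the factor
    1/2. *)
Lemma cov_ext2E A (w : ad_field P 2) a i y mu nu rho :
  (forall b c, w a i y [tuple b; c] = - w a i y [tuple c; b]) ->
  cov_ext A w a i y [tuple mu; nu; rho] =
  pderiv mu (fun z => w a i z [tuple nu; rho]) y
  - pderiv nu (fun z => w a i z [tuple mu; rho]) y
  + pderiv rho (fun z => w a i z [tuple mu; nu]) y
  + (lie_bracket (conn_field A a i y [tuple mu]) (w a i y [tuple nu; rho])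
     - lie_bracket (conn_field A a i y [tuple nu]) (w a i y [tuple mu; rho])
     + lie_bracket (conn_field A a i y [tuple rho]) (w a i y [tuple mu; nu])).
Proof.
move=> alt; congr (_ + _); first exact: exterior2.
apply: (etrans (wedge12 _ _ _ _ _ _ _ _)); rewrite /=.
rewrite (alt rho nu) (alt rho mu) (alt nu mu) !raddfN /=.
move: (lie_bracket _ _) (lie_bracket _ _) (lie_bracket _ _) => X Y Z.
by apply/matrixP => r s; rewrite !mxE; field.
Qed.

End BundleCalculus.

(** * Matrix identities behind the differential identities *)

Lemma is_derive_add (K : numFieldType) (V W : normedModType K) (f h : V -> W)
    x v df dh : is_derive x v f df -> is_derive x v h dh ->
  is_derive x v (fun z => f z + h z) (df + dh).
Proof. exact: is_deriveD. Qed.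

Lemma is_derive_sub (K : numFieldType) (V W : normedModType K) (f h : V -> W)
    x v df dh : is_derive x v f df -> is_derive x v h dh ->
  is_derive x v (fun z => f z - h z) (df - dh).
Proof. exact: is_deriveB. Qed.

(** Unlike [mxE], this and the next two lemmas leave entries of matrix products folded, so that
    [ring] can treat noncommutative monomials as atoms. *)
Lemma addmxE (R : nmodType) n p (X Y : 'M[R]_(n, p)) r s : (X + Y) r s = X r s + Y r s.
Proof. by rewrite mxE. Qed.

Lemma oppmxE (R : zmodType) n p (X : 'M[R]_(n, p)) r s : (- X) r s = - X r s.
Proof. by rewrite mxE. Qed.

Lemma zeromxE (R : nmodType) n p r s : (0 : 'M[R]_(n, p)) r s = 0.
Proof. by rewrite mxE. Qed.

Ltac lie_ring :=
  rewrite /lie_bracket !(mulmxDl, mulmxDr, mulmxBl, mulmxBr, mulmxN, mulNmx, mulmxA);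
  apply/matrixP => r s; rewrite !(addmxE, oppmxE, zeromxE); ring.

(** [Z] stands for [B], [X] and [Y] for the components of [A] along [mu] and [nu]. The terms with
    first derivatives of [B] cancel, and the double brackets combine by the Jacobi identity. *)
Lemma cov_ext_cov_ext_algebra N (R : realType) (Z X Y dX dY dZ dZ' ddZ : 'M[R]_N) :
  ddZ + (lie_bracket dY Z + lie_bracket Y dZ)
  - (ddZ + (lie_bracket dX Z + lie_bracket X dZ'))
  + (lie_bracket X (dZ' + lie_bracket Y Z) - lie_bracket Y (dZ + lie_bracket X Z))
  = lie_bracket (dY - dX + lie_bracket X Y) Z.
Proof. lie_ring. Qed.

(** [X], [Y], [Z] are the components of [A] along [mu], [nu], [rho]; [XY] is the derivative along
    [mu] of [Y], and so on; [u], [v], [w] are the second derivatives. The double brackets cancel by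
    the Jacobi identity. *)
Lemma bianchi_algebra N (R : realType) (X Y Z YX ZX XY ZY XZ YZ u v w : 'M[R]_N) :
  u - v + (lie_bracket XY Z + lie_bracket Y XZ)
  - (u - w + (lie_bracket YX Z + lie_bracket X YZ))
  + (v - w + (lie_bracket ZX Y + lie_bracket X ZY))
  + (lie_bracket X (YZ - ZY + lie_bracket Y Z)
     - lie_bracket Y (XZ - ZX + lie_bracket X Z)
     + lie_bracket Z (XY - YX + lie_bracket X Y)) = 0.
Proof. lie_ring. Qed.

(** The hypothesis is a component of [d zeta = 0]; it removes the terms in which [B] is not
    differentiated or bracketed. *)
Lemma form_leibniz_algebra N (R : realType) (z1 z2 z3 dz1 dz2 dz3 : R)
    (B X1 X2 X3 dB1 dB2 dB3 : 'M[R]_N) : dz1 - dz2 + dz3 = 0 ->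
  (dz1 *: B + z1 *: dB1) - (dz2 *: B + z2 *: dB2) + (dz3 *: B + z3 *: dB3)
  + (lie_bracket X1 (z1 *: B) - lie_bracket X2 (z2 *: B) + lie_bracket X3 (z3 *: B))
  = z1 *: (dB1 + lie_bracket X1 B) - z2 *: (dB2 + lie_bracket X2 B)
    + z3 *: (dB3 + lie_bracket X3 B).
Proof.
move=> dz; have -> : dz1 = dz2 - dz3.
  by apply/eqP; rewrite -subr_eq0 opprB addrCA addrC dz.
have brZ c X : lie_bracket X (c *: B) = c *: lie_bracket X B by exact: linearZ_LR.
rewrite !brZ; move: (lie_bracket X1 B) (lie_bracket X2 B) (lie_bracket X3 B) => Y1 Y2 Y3.
by apply/matrixP => r s; rewrite !mxE; ring.
Qed.

(** * The square of the covariant derivative, the Bianchi identity, and the Leibniz rule for a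
    closed two-form *)

Section BundleIdentities.
Context {R : realType} {m N : nat} {M : oriented_manifold R m}
        {G : set 'M[R]_N} {P : principal_bundle M G}.
Implicit Types (A : connection P) (B : ad_form P 0).

Lemma alternating2 (V : lmodType R) (w : 2.-tuple 'I_m -> V) a b :
  Defs.alternating w -> w [tuple b; a] = - w [tuple a; b].
Proof.
move=> /(_ (tperm ord0 (lift ord0 ord0)) [tuple a; b]).
rewrite odd_tperm expr1 scaleN1r mktuple2 => <-.
by rewrite tpermL tpermR; congr w; apply: val_inj.
Qed.

Lemma curvature_alt A a i y b c :
  curvature A a i y [tuple b; c] = - curvature A a i y [tuple c; b].
Proof.
by rewrite !curvatureE opprD opprB -lie_bracketC.
Qed.

Lemma is_derive_conn A a i y I mu : Defs.patch a i y ->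
  is_derive y (basis_vec mu) (fun z => conn_field A a i z I)
    (pderiv mu (fun z => conn_field A a i z I) y).
Proof. exact: (pderivP _ (conn_smooth A a i I)). Qed.

Lemma is_derive_dconn A a i y I mu nu : Defs.patch a i y ->
  is_derive y (basis_vec mu) (pderiv nu (fun z => conn_field A a i z I))
    (pderiv mu (pderiv nu (fun z => conn_field A a i z I)) y).
Proof. exact: (pderivP _ (smooth_pderiv _ (conn_smooth A a i I))). Qed.

Lemma is_derive_ad k (w : ad_form P k) a i y I mu : Defs.patch a i y ->
  is_derive y (basis_vec mu) (fun z => ad_form_field w a i z I)
    (pderiv mu (fun z => ad_form_field w a i z I) y).
Proof. exact: (pderivP _ (ad_form_smooth w a i I)). Qed.

Lemma is_derive_dad k (w : ad_form P k) a i y I mu nu : Defs.patch a i y ->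
  is_derive y (basis_vec mu) (pderiv nu (fun z => ad_form_field w a i z I))
    (pderiv mu (pderiv nu (fun z => ad_form_field w a i z I)) y).
Proof. exact: (pderivP _ (smooth_pderiv _ (ad_form_smooth w a i I))). Qed.

Lemma is_derive_curvature A a i y mu b c : Defs.patch a i y ->
  is_derive y (basis_vec mu) (fun z => curvature A a i z [tuple b; c])
   (pderiv mu (pderiv b (fun z => conn_field A a i z [tuple c])) y
    - pderiv mu (pderiv c (fun z => conn_field A a i z [tuple b])) y
    + (lie_bracket (pderiv mu (fun z => conn_field A a i z [tuple b]) y)
         (conn_field A a i y [tuple c])
       + lie_bracket (conn_field A a i y [tuple b])
         (pderiv mu (fun z => conn_field A a i z [tuple c]) y))).
Proof.
move=> Py; rewrite (_ : (fun z => curvature A a i z [tuple b; c]) = (fun z =>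
    pderiv b (fun z => conn_field A a i z [tuple c]) z
    - pderiv c (fun z => conn_field A a i z [tuple b]) z
    + lie_bracket (conn_field A a i z [tuple b]) (conn_field A a i z [tuple c]))).
  exact: (is_derive_add
    (is_derive_sub (is_derive_dconn A _ mu b Py) (is_derive_dconn A _ mu c Py))
    (is_derive_bracket (is_derive_conn A _ mu Py) (is_derive_conn A _ mu Py))).
by apply/funext => z; exact: curvatureE.
Qed.

Lemma is_derive_cov_ext0 A B a i y mu nu : Defs.patch a i y ->
  is_derive y (basis_vec mu) (fun z => cov_ext A B a i z [tuple nu])
   (pderiv mu (pderiv nu (fun z => ad_form_field B a i z [tuple])) y
    + (lie_bracket (pderiv mu (fun z => conn_field A a i z [tuple nu]) y)
         (ad_form_field B a i y [tuple])
       + lie_bracket (conn_field A a i y [tuple nu])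
         (pderiv mu (fun z => ad_form_field B a i z [tuple]) y))).
Proof.
move=> Py; rewrite (_ : (fun z => cov_ext A B a i z [tuple nu]) = (fun z =>
    pderiv nu (fun z => ad_form_field B a i z [tuple]) z
    + lie_bracket (conn_field A a i z [tuple nu]) (ad_form_field B a i z [tuple]))).
  exact: (is_derive_add (is_derive_dad B _ mu nu Py)
    (is_derive_bracket (is_derive_conn A _ mu Py) (is_derive_ad B _ mu Py))).
by apply/funext => z; exact: cov_ext0E.
Qed.

Lemma cov_ext_cov_ext A B :
  ad_eq (cov_ext A (cov_ext A B))
    (fun a i y I => lie_bracket (curvature A a i y I) (ad_form_field B a i y [tuple])).
Proof.
move=> a i y I Py; have [mu [nu ->]] := tuple2P I.
rewrite cov_ext1E !(pderiv_val (is_derive_cov_ext0 _ _ _ _ Py)) !cov_ext0E curvatureE.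
rewrite (pderiv_comm mu nu (@patch_open _ _ _ _ _ _ a i) Py (ad_form_smooth B a i _)).
exact: cov_ext_cov_ext_algebra.
Qed.

Lemma bianchi A : ad_eq (cov_ext A (curvature A)) (ad_zero P 3).
Proof.
move=> a i y I Py; have [mu [nu [rho ->]]] := tuple3P I.
rewrite cov_ext2E; last exact: curvature_alt.
rewrite !(pderiv_val (is_derive_curvature _ _ _ _ Py)) !curvatureE.
have dC b c e := pderiv_comm b c (@patch_open _ _ _ _ _ _ a i) Py (conn_smooth A a i [tuple e]).
(* Brings the six second derivatives of [A] to a common order, leaving three that each occur with
   both signs. *)
rewrite (dC rho mu) (dC rho nu) (dC nu mu) /ad_zero.
exact: bianchi_algebra.
Qed.

Section FormWedge.
Context (zeta : diff_form M 2).

Lemma form_wedge0E (w : ad_field P 0) :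
  ad_eq (form_wedge zeta w) (fun a i y I => form_field zeta i y I *: w a i y [tuple]).
Proof.
move=> a i y I [iy _]; have [mu [nu ->]] := tuple2P I.
apply: (etrans (wedge20 _ _ _ _ _ _ _)).
rewrite (alternating2 mu nu (form_alt zeta iy)).
by apply/matrixP => r s; rewrite !mxE; field.
Qed.

Lemma form_wedge1E (w : ad_field P 1) a i y mu nu rho : cimg i y ->
  form_wedge zeta w a i y [tuple mu; nu; rho] =
  form_field zeta i y [tuple nu; rho] *: w a i y [tuple mu]
  - form_field zeta i y [tuple mu; rho] *: w a i y [tuple nu]
  + form_field zeta i y [tuple mu; nu] *: w a i y [tuple rho].
Proof.
move=> iy; apply: (etrans (wedge21 _ _ _ _ _ _ _ _)) => /=.
have alt b c := alternating2 b c (form_alt zeta iy).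
rewrite (alt mu nu) (alt mu rho) (alt nu rho).
by apply/matrixP => r s; rewrite !mxE; field.
Qed.

Lemma is_derive_scale_form B a i y I mu : Defs.patch a i y ->
  is_derive y (basis_vec mu)
    (fun z => form_field zeta i z I *: ad_form_field B a i z [tuple])
    (pderiv mu (fun z => form_field zeta i z I) y *: ad_form_field B a i y [tuple]
     + form_field zeta i y I *: pderiv mu (fun z => ad_form_field B a i z [tuple]) y).
Proof.
move=> Py; apply: is_derive_scalemx; last exact: is_derive_ad.
exact: (pderivP _ (form_smooth zeta i I) Py.1).
Qed.

Lemma cov_ext_form_wedge A B : closed_form zeta ->
  ad_eq (cov_ext A (form_wedge zeta B)) (form_wedge zeta (cov_ext A B)).
Proof.
move=> dz a i y I Py; have [mu [nu [rho ->]]] := tuple3P I.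
(* On the patch the wedge with a function is a pointwise product, to which the product rule
   applies. *)
rewrite (eq_cov_ext _ (form_wedge0E B)) // cov_ext2E; last first.
  by move=> b c; rewrite (alternating2 c b (form_alt zeta Py.1)) scaleNr.
rewrite form_wedge1E; last exact: Py.1.
rewrite !(pderiv_val (is_derive_scale_form _ _ _ Py)) !cov_ext0E.
have := dz i y [tuple mu; nu; rho] Py.1; rewrite exterior2.
exact: form_leibniz_algebra.
Qed.

End FormWedge.

End BundleIdentities.

(** * Both cone Yang-Mills equations, with the choice of sign carried by a scalar [e] of square 1 *)

Section BogomolnyImpliesConeYangMills.
Context {R : realType} {N : nat} {G : set 'M[R]_N} {M : oriented_manifold R 3}.
Context (g : riemannian_metric M) (P : principal_bundle M G).
Context (zeta : diff_form M 2) (hzeta : closed_form zeta).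
Context (A : connection P) (B : ad_form P 0) (e : R) (e2 : e * e = 1).

Let phi : ad_field P 1 := cov_ext A B.
Let Omega : ad_field P 2 := ad_add (curvature A) (form_wedge zeta B).
Context (bogomolny : ad_eq Omega (ad_scale e (ad_hodge g phi))).

Let hodge_phi : ad_eq (ad_hodge g phi : ad_field P 2) (ad_scale e Omega).
Proof. by move=> a i y I Py; rewrite /ad_scale bogomolny // scalerA e2 scale1r. Qed.

(** The star is applied to the first-order equation; it commutes with scaling by [e] and squares to
    1 on [phi]. *)
Let hodge_Omega : ad_eq (ad_hodge g Omega : ad_field P 1) (ad_scale e phi).
Proof.
move=> a i y I Py; rewrite /ad_scale -(hodge_hodge1 g (phi a) I Py.1).
exact: (@hodge_linear R 3 M g _ _ 2 (hodge g (phi a)) (Omega a) ( *:%R e) i y I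
  (fun J => bogomolny J Py)).
Qed.

Let phi_derivable : ad_derivable phi.
Proof.
move=> a i y I mu Py; have [nu ->] := tuple1P I.
by have [] := is_derive_cov_ext0 A B mu nu Py.
Qed.

Let form_wedge_derivable : ad_derivable (form_wedge zeta B).
Proof.
move=> a i y I mu Py; have [] := is_derive_scale_form zeta B I mu Py.
move=> dB _; apply: near_eq_derivable dB.
have := open_nbhs_nbhs (conj (@patch_open _ _ _ _ _ _ a i) Py).
by apply: filterS => z Pz; rewrite form_wedge0E.
Qed.

Let curvature_derivable : ad_derivable (curvature A).
Proof.
move=> a i y I mu Py; have [b [c ->]] := tuple2P I.
by have [] := is_derive_curvature A mu b c Py.
Qed.

Let Omega_derivable : ad_derivable Omega.
Proof.
by move=> a i y I mu Py; apply: derivableD;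
  [exact: curvature_derivable | exact: form_wedge_derivable].
Qed.

(** The curvature contributes nothing by the Bianchi identity, and [zeta] passes through the
    derivative because it is closed. *)
Let cov_ext_Omega : ad_eq (cov_ext A Omega) (form_wedge zeta phi).
Proof.
move=> a i y I Py; rewrite (cov_extD A curvature_derivable form_wedge_derivable) //.
by rewrite /ad_add bianchi // add0r cov_ext_form_wedge.
Qed.

(** The bracket of [zeta B] with [B] vanishes, so [F_A] may be completed to [Omega], the quantity
    that the first-order equation controls. *)
Let cov_ext_phi : ad_eq (cov_ext A phi)
  (fun a i y I => lie_bracketr (ad_form_field B a i y [tuple]) (Omega a i y I)).
Proof.
move=> a i y I Py; rewrite /phi cov_ext_cov_ext // /Omega /ad_add linearD.
by rewrite form_wedge0E // linearZ_LR /= /lie_bracketr lie_bracketxx scaler0 addr0.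
Qed.

Lemma first_cone_yang_mills :
  ad_eq (ad_add (cov_codiff g A Omega) (ad_bracket B (cov_ext A B))) (ad_zero P 1).
Proof.
move=> a i y I Py; have [mu ->] := tuple1P I.
have -> : ad_zero P 1 a i y [tuple mu] = 0 by [].
have E1 : ad_bracket B (cov_ext A B) a i y [tuple mu]
    = lie_bracket (ad_form_field B a i y [tuple]) (phi a i y [tuple mu]).
  exact: wedge01.
rewrite {1}/ad_add E1 /cov_codiff /ad_scale.
(* On two-forms in dimension three the formal adjoint carries the sign +1. *)
rewrite (_ : (-1) ^+ (3 * 2 + 3 + 1) = 1); last by rewrite -signr_odd.
(* One factor [e] comes from the star of [Omega], the other from rewriting [Omega] as [e] times the
   star of [phi]; their product is 1. *)
have E2 J : cov_ext A (ad_hodge g Omega : ad_field P 1) a i y J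
    = lie_bracketr (ad_form_field B a i y [tuple]) (ad_hodge g phi a i y J).
  rewrite (eq_cov_ext A hodge_Omega) // (cov_extZ A e phi_derivable) //.
  by rewrite /ad_scale cov_ext_phi // bogomolny // linearZ_LR scalerA e2 scale1r.
(* The outer star commutes with the bracket by [B] and cancels the inner one, leaving the bracket of
   [phi] with [B], opposite to the second term. *)
have := @hodge_linear R 3 M g _ _ 2 (hodge g (phi a))
  (cov_ext A (ad_hodge g Omega : ad_field P 1) a)
  (lie_bracketr (ad_form_field B a i y [tuple])) i y [tuple mu] E2.
rewrite (hodge_hodge1 g (phi a) [tuple mu] Py.1) => E3.
apply/eqP; rewrite scale1r addr_eq0 -lie_bracketC; apply/eqP; exact: E3.
Qed.

Lemma second_cone_yang_mills :
  ad_eq (ad_add (form_wedge_adj g zeta Omega) (cov_codiff g A (cov_ext A B)))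
    (ad_zero P 0).
Proof.
move=> a i y I Py.
(* Both terms of the equation are, up to sign, the star of the three-form
   [e *: form_wedge zeta phi]. *)
have E1 J : form_wedge zeta (ad_hodge g Omega : ad_field P 1) a i y J
    = e *: form_wedge zeta phi a i y J.
  rewrite -(wedgeZr (fun c : R^o => *:%R c)).
  by apply: eq_wedge => K; exact: hodge_Omega.
have E2 J : cov_ext A (ad_hodge g phi : ad_field P 2) a i y J
    = e *: form_wedge zeta phi a i y J.
  rewrite (eq_cov_ext A hodge_phi) // (cov_extZ A e Omega_derivable) //.
  by rewrite /ad_scale cov_ext_Omega.
rewrite /ad_add /form_wedge_adj /cov_codiff /ad_scale.
(* The adjoint of the wedge has sign +1 on two-forms and the codifferential -1 on one-forms, so the
   two terms cancel. *)
rewrite (_ : (-1) ^+ ((3 - 2) * 2) = 1); last by rewrite -signr_odd.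
rewrite (_ : (-1) ^+ (3 * 1 + 3 + 1) = -1); last by rewrite -signr_odd.
have E3 := @hodge_linear R 3 M g _ _ 3 (form_wedge zeta phi a)
  (form_wedge zeta (ad_hodge g Omega : ad_field P 1) a) ( *:%R e) i y I E1.
have E4 := @hodge_linear R 3 M g _ _ 3 (form_wedge zeta phi a)
  (cov_ext A (ad_hodge g phi : ad_field P 2) a) ( *:%R e) i y I E2.
rewrite scale1r scaleN1r; apply/eqP; rewrite subr_eq0; apply/eqP.
exact: etrans E3 (esym E4).
Qed.

End BogomolnyImpliesConeYangMills.

Theorem mainTheorem3 (R : realType) (N : nat) (G : set 'M[R]_N)
    (hG : compact_subgroup_SO G)
    (M : oriented_manifold R 3) (g : riemannian_metric M)
    (P : principal_bundle M G)
    (zeta : diff_form M 2) (hzeta : closed_form zeta)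
    (A : connection P) (B : ad_form P 0) :
  ad_eq (ad_add (curvature A) (form_wedge zeta B))
        (ad_hodge g (cov_ext A B))
  \/
  ad_eq (ad_add (curvature A) (form_wedge zeta B))
        (ad_opp (ad_hodge g (cov_ext A B))) ->
  ad_eq (ad_add (cov_codiff g A (ad_add (curvature A) (form_wedge zeta B)))
                (ad_bracket B (cov_ext A B)))
        (ad_zero P 1)
  /\
  ad_eq (ad_add (form_wedge_adj g zeta
                   (ad_add (curvature A) (form_wedge zeta B)))
                (cov_codiff g A (cov_ext A B)))
        (ad_zero P 0).
Proof.
move=> bogomolny.
have [e e2 He] : exists2 e : R, e * e = 1 &
    ad_eq (ad_add (curvature A) (form_wedge zeta B))
      (ad_scale e (ad_hodge g (cov_ext A B))).
  case: bogomolny => H;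
    [exists 1; first by rewrite mulr1 | exists (-1); first by rewrite mulrNN mulr1].
    by move=> a i y I Py; rewrite H // /ad_scale scale1r.
  by move=> a i y I Py; rewrite H // /ad_scale scaleN1r.
split; first exact: (first_cone_yang_mills e2 He).
exact: (second_cone_yang_mills hzeta e2 He).
Qed.
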